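(* Let $X$ and $Y$ be Banach spaces and let $T,S\in\mathcal{B}(X,Y)$. Then $$\bigcup_{t>0}t\operatorname*{arg\,max}_{\|S(x)\|\leq 1}\|T(x)\| = \operatorname*{arg\,max}_{\|S(x)\|\neq 0} \frac{\|T(x)\|}{\|S(x)\|}.$$
   Context: Banach spaces are real or complex, and $\mathcal{B}(X,Y)$ denotes the space of bounded linear operators from $X$ to $Y$. $\operatorname*{arg\,max}_{\|S(x)\|\leq 1}\|T(x)\|$ is the (possibly empty) set of all $x_0\in X$ with $\|S(x_0)\|\leq 1$ such that $\|T(x_0)\|\geq \|T(x)\|$ for all $x\in X$ with $\|S(x)\|\leq 1$. $\operatorname*{arg\,max}_{\|S(x)\|\neq 0}\frac{\|T(x)\|}{\|S(x)\|}$ is the (possibly empty) set of all $x_0\in X$ with $\|S(x_0)\|\neq 0$ such that $\frac{\|T(x_0)\|}{\|S(x_0)\|}\geq \frac{\|T(x)\|}{\|S(x)\|}$ for all $x\in X$ with $\|S(x)\|\neq 0$. For a real number $t$ and a set $M\subseteq X$, $tM=\{tx:x\in M\}$.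
   Formalization: The hypothesis T ≠ 0 is added: for T = 0 the stated equality always fails, since 0 belongs to the left-hand side but not to the right-hand side. *)

(* Defs.v *)
From mathcomp Require Import all_boot all_order all_algebra.
From mathcomp Require Import complex.
From mathcomp Require Import all_classical all_reals all_analysis.

Set Implicit Arguments.
Unset Strict Implicit.
Unset Printing Implicit Defensive.

Import Order.TTheory GRing.Theory Num.Theory.
Import numFieldNormedType.Exports.

Local Open Scope classical_set_scope.
Local Open Scope ring_scope.

Variant scalar_kind := RealScalars | ComplexScalars.

Definition scalar_field (R : realType) (k : scalar_kind) : numFieldType :=
  match k with
  | RealScalars => R
  | ComplexScalars => R[i]
  end.

(* Norms take their values in the scalar field K. When K is R[i], these values
   are nonnegative reals, and the partial order is such that 0 < t holds exactly
   when t is a positive real, so (t : K) with 0 < t is a positive real number. *)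
Definition argmax (K : numFieldType) (X : Type) (D : set X) (f : X -> K) :
  set X := [set x0 | D x0 /\ forall x, D x -> f x <= f x0].

Definition dilate (K : numFieldType) (X : lmodType K) (t : K) (M : set X) :
  set X := [set t *: x | x in M].

(* Main.v *)
Require Import Defs.
From mathcomp Require Import all_boot all_order all_algebra.
From mathcomp Require Import all_classical all_reals all_analysis.
From mathcomp Require Import ring.
Import Order.TTheory GRing.Theory Num.Theory.
Import numFieldNormedType.Exports.
Local Open Scope classical_set_scope.
Local Open Scope ring_scope.

(** Both sides are invariant under positive scaling, so a feasible point [x]
    with [S x <> 0] may be normalised to [|S x| = 1]. What remains is the kernel
    of [S]. A maximiser on the left cannot lie in it, since its multiples are
    feasible and [T] would vanish. If [x0] maximises the quotient and
    [S x = 0], then testing with [x + e *: x0] gives [|T x| <= 2 e |T x0|] for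
    every [e > 0], so [T x = 0]. *)

Section Maximisers.
Context {K : numFieldType} {X Y : normedModType K} (T S : {linear X -> Y}).

Local Notation ball_argmax :=
  (argmax [set x : X | `|S x| <= 1] (fun x => `|T x|)).
Local Notation quotient_argmax :=
  (argmax [set x : X | `|S x| != 0] (fun x => `|T x| / `|S x|)).

Lemma norm_linearZ (L : {linear X -> Y}) (t : K) (x : X) :
  0 <= t -> `|L (t *: x)| = t * `|L x|.
Proof. by move=> t0; rewrite linearZ normrZ ger0_norm. Qed.

Lemma norm_linear_normalize (x : X) :
  `|S x| != 0 -> `|S (`|S x|^-1 *: x)| = 1.
Proof. by move=> Sx; rewrite norm_linearZ ?invr_ge0// mulVf. Qed.

Lemma quotient_argmaxZ (t : K) (x : X) :
  0 < t -> quotient_argmax x -> quotient_argmax (t *: x).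
Proof.
move=> t0 [Sx xmax]; split => [|y Sy] /=.
  by rewrite norm_linearZ ?(ltW t0)// mulf_neq0// gt_eqF.
rewrite !norm_linearZ ?(ltW t0)// -mulf_div divff ?gt_eqF// mul1r.
exact: xmax.
Qed.

Lemma quotient_argmax_ker {x0 x : X} :
  quotient_argmax x0 -> S x = 0 -> T x = 0.
Proof.
move=> [/= Sx0 x0max] Sx.
have bound (e : K) : 0 < e -> `|T x| <= e * `|T x0| *+ 2.
  move=> e0.
  have SE : `|S (x + e *: x0)| = e * `|S x0|.
    by rewrite linearD Sx add0r norm_linearZ ?(ltW e0).
  have Sx0_gt0 : 0 < `|S x0| by rewrite lt0r Sx0 normr_ge0.
  have := x0max (x + e *: x0); rewrite /= SE mulf_neq0 ?gt_eqF// => /(_ isT).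
  rewrite ler_pdivrMr ?mulr_gt0// mulrCA divfK// => le_e.
  (* [le_e] controls only [T (x + e *: x0)]; removing [e *: x0] by the triangle inequality costs the
     second summand. *)
  rewrite -[x](addrK (e *: x0)) linearB (le_trans (ler_normB _ _))//.
  by rewrite norm_linearZ ?(ltW e0)// mulr2n lerD2r.
apply/eqP; apply: contraT => Tx.
have Tx_gt0 : 0 < `|T x| by rewrite normr_gt0.
have Tx0_gt0 : 0 < `|T x0|.
  by have := lt_le_trans Tx_gt0 (bound 1 ltr01); rewrite mul1r pmulrn_lgt0.
(* This choice of [e] turns the bound into [|T x| <= |T x| / 2], which is impossible for
   [T x <> 0]. *)
have := bound (`|T x| / `|T x0| / 4).
rewrite !divr_gt0// => /(_ isT).
rewrite (_ : _ *+ 2 = `|T x| / 2); last by field; rewrite gt_eqF.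
by rewrite ler_pdivlMr// ger_pMr// lern1.
Qed.

Lemma ball_argmax_neq0 {x0 : X} :
  (T : X -> Y) <> (fun=> 0) -> ball_argmax x0 -> `|S x0| != 0.
Proof.
move=> T0 [/= _ x0max]; apply/eqP => Sx0; apply: T0; apply/funext => x.
have Tx0 : `|T x0| = 0.
  (* Feasible because [S x0 = 0]; maximality then gives [2 * |T x0| <= |T x0|]. *)
  have := x0max (2 *: x0); rewrite /= !norm_linearZ// Sx0 mulr0 => /(_ ler01).
  by rewrite mulr_natl mulr2n gerDl => Tx0; apply/le_anti; rewrite Tx0 normr_ge0.
apply/eqP; rewrite -normr_eq0.
(* The maximum is 0, so [T] vanishes on the whole feasible set; rescaling extends this to every
   [x]. *)
have ball0 y : `|S y| <= 1 -> `|T y| = 0.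
  by move=> /x0max; rewrite Tx0 => Ty; apply/le_anti; rewrite Ty normr_ge0.
have [Sx|Sx] := eqVneq `|S x| 0; first by rewrite ball0// Sx ler01.
have /ball0/eqP : `|S (`|S x|^-1 *: x)| <= 1 by rewrite norm_linear_normalize.
by rewrite norm_linearZ ?invr_ge0// mulf_eq0 invr_eq0 (negPf Sx).
Qed.

Lemma ball_argmax_quotient {x0 : X} :
  (T : X -> Y) <> (fun=> 0) -> ball_argmax x0 -> quotient_argmax x0.
Proof.
move=> T0 x0max; have Sx0 := ball_argmax_neq0 T0 x0max.
case: x0max => /= Sx0_le1 x0max; split=> //= x Sx.
(* This gives [|T x| / |S x| <= |T x0|], and dividing the right side by [|S x0| <= 1] can only
   enlarge it. *)
have := x0max (`|S x|^-1 *: x); rewrite /= norm_linear_normalize// lexx.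
move=> /(_ isT); rewrite norm_linearZ ?invr_ge0// mulrC => /le_trans; apply.
by rewrite ler_peMr// invf_ge1// lt0r Sx0 normr_ge0.
Qed.

Lemma quotient_argmax_ball {x0 : X} :
  quotient_argmax x0 -> ball_argmax (`|S x0|^-1 *: x0).
Proof.
move=> x0max; have [/= Sx0 quotient_le] := x0max.
split=> /= [|x Sx_le1]; first by rewrite norm_linear_normalize.
rewrite norm_linearZ ?invr_ge0// mulrC.
(* If [S x = 0], maximality of the quotient does not apply to [x] directly, so the kernel lemma
   supplies [T x = 0]. *)
have [/eqP|Sx] := eqVneq `|S x| 0.
  rewrite normr_eq0 => /eqP /(quotient_argmax_ker x0max) ->.
  by rewrite normr0 divr_ge0.
(* As [|S x| <= 1], [|T x|] is at most the quotient at [x]. *)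
apply: le_trans (quotient_le _ Sx).
by rewrite ler_peMr// invf_ge1// lt0r Sx normr_ge0.
Qed.

Lemma dilate_ball_argmax :
  (T : X -> Y) <> (fun=> 0) ->
  \bigcup_(t in [set t : K | 0 < t]) dilate t ball_argmax = quotient_argmax.
Proof.
move=> T0; apply/seteqP; split=> [_ [t t0 [x xmax <-]]|x xmax].
  exact/quotient_argmaxZ/ball_argmax_quotient.
have [/= Sx _] := xmax.
exists `|S x|; first by rewrite /= lt0r Sx normr_ge0.
exists (`|S x|^-1 *: x); first exact: quotient_argmax_ball.
by rewrite scalerA divff// scale1r.
Qed.

End Maximisers.

Theorem theorem3p4 (R : realType) (k : scalar_kind)
  (X Y : completeNormedModType (scalar_field R k))
  (T S : {linear X -> Y})
  (T_bounded : bounded_near T (nbhs (0 : X)))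
  (S_bounded : bounded_near S (nbhs (0 : X)))
  (* needed: for T = 0 the point 0 belongs only to the left-hand side *)
  (T_neq0 : (T : X -> Y) <> (fun=> 0)) :
  \bigcup_(t in [set t : scalar_field R k | 0 < t])
     dilate t (argmax [set x : X | `|S x| <= 1] (fun x => `|T x|))
  = argmax [set x : X | `|S x| != 0] (fun x => `|T x| / `|S x|).
Proof.
exact: dilate_ball_argmax.
Qed.
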